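(* Let $0<\alpha \le 1/8$ and let $\mathsf{Halver}$ be a data-oblivious $\alpha$-halver procedure operating on pairs of equal-sized arrays whose size is a power of $2$. Then the procedure $\mathsf{Attenuate}$ (defined in the context, built from $\mathsf{Halver}$), when prefaced by an $\alpha$-halver operation $\mathsf{Halver}(A,B)$ on its input pair $(A,B)$, is an $\epsilon$-halver for $\epsilon = \alpha^2(\lceil \log_2(1/\alpha)\rceil + 3)$.
   Context: A compare-exchange on positions $(p,q)$ replaces the values $(x,y)$ there by $(\min(x,y),\max(x,y))$; a procedure is data-oblivious if its sequence of compare-exchanges/memory accesses is independent of the input values. For $\epsilon\ge0$, an $\epsilon$-halver is a data-oblivious procedure that, given arrays $(A,B)$ each of size $n$, performs compare-exchanges so that afterwards, for every $k\le n$, at most $\epsilon k$ of the $k$ largest elements of $A\cup B$ are in $A$ and at most $\epsilon k$ of the $k$ smallest are in $B$. ''Sort $A\cup B$'' means rearranging the $2n$ items so that the concatenation $AB$ is in nondecreasing order; ''partition $E$ into halves $F,G$'' means viewing the first half of subarray $E$ as $F$ and the second half as $G$. Procedure $\mathsf{Attenuate}(A,B)$, with $|A|=|B|=n$ a power of 2: if $n\le 8$, sort $A\cup B$ and return. Otherwise partition $A$ into halves $A_1,A_2$ and $B$ into halves $B_1,B_2$; run $\mathsf{Halver}(A_1,A_2)$, $\mathsf{Halver}(B_1,B_2)$, $\mathsf{Halver}(A_2,B_1)$, then $\mathsf{Attenuate}(A_2,B_1)$; then partition $A_2$ into halves $A_{21},A_{22}$ and $B_1$ into halves $B_{11},B_{12}$;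 run $\mathsf{Halver}(A_{21},A_{22})$, $\mathsf{Halver}(B_{11},B_{12})$, $\mathsf{Halver}(A_{22},B_{11})$, then $\mathsf{Attenuate}(A_{22},B_{11})$. *)

(* Defs.v *)
From HB Require Import structures.
From mathcomp Require Import all_boot all_order all_algebra.
From mathcomp Require Import reals exp.

Set Implicit Arguments.
Unset Strict Implicit.
Unset Printing Implicit Defensive.

Import Order.TTheory GRing.Theory Num.Theory.

(* A data-oblivious procedure is a sequence of position pairs, fixed before
   any value is read.  A pair (p, q) need not satisfy p < q. *)
Definition network (I : Type) := seq (I * I).

Definition compare_exchange (d : Order.disp_t) (T : orderType d) (I : eqType)
    (t : I -> T) (e : I * I) : I -> T :=
  fun r => if r == e.1 then Order.min (t e.1) (t e.2)
           else if r == e.2 then Order.max (t e.1) (t e.2)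
           else t r.

Definition run (d : Order.disp_t) (T : orderType d) (I : eqType)
    (net : network I) (t : I -> T) : I -> T :=
  foldl (@compare_exchange d T I) t net.

(* A pair of arrays (A, B) of size n is indexed by 'I_(n + n): A is the image
   of lshift n and B the image of rshift n.  Entries are taken distinct, which
   makes "the k largest" and "the k smallest" unambiguous: an entry is among
   the k largest iff fewer than k entries exceed it. *)
Definition halver (R : numDomainType) (d : Order.disp_t) (T : orderType d)
    (eps : R) (n : nat) (net : network 'I_(n + n)) : Prop :=
  forall t : 'I_(n + n) -> T, injective t ->
  forall k : nat, k <= n ->
  let u := run net t in
  let large p := #|[set q | (u p < u q)%O]| < k in
  let small p := #|[set q | (u q < u p)%O]| < k in
  (#|[set i : 'I_n | large (lshift n i)]|%:R <= eps * k%:R)%R /\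
  (#|[set i : 'I_n | small (rshift n i)]|%:R <= eps * k%:R)%R.

Definition sorting_network (d : Order.disp_t) (T : orderType d) (N : nat)
    (net : network 'I_N) : Prop :=
  forall (t : 'I_N -> T) (p q : 'I_N),
    p <= q -> (run net t p <= run net t q)%O.

(* An array of size n inside a memory with addresses in I is represented by
   the function sending an index to its address. *)
Definition call (I : Type) (n : nat) (net : network 'I_(n + n))
    (A B : 'I_n -> I) : network I :=
  let addr i := match split i with inl a => A a | inr b => B b end in
  [seq (addr e.1, addr e.2) | e <- net].

Definition pow2 (n : nat) : Prop := exists m : nat, n = 2 ^ m.

Lemma half1_subproof (n : nat) (i : 'I_n./2) : i < n.
Proof. by rewrite (leq_trans (ltn_ord i)) // -divn2 leq_div. Qed.

Lemma half2_subproof (n : nat) (i : 'I_n./2) : n./2 + i < n.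
Proof.
apply: (@leq_trans (n./2 + n./2)); first by rewrite ltn_add2l.
by rewrite addnn -{2}(odd_double_half n) leq_addl.
Qed.

Definition half1 (I : Type) (n : nat) (E : 'I_n -> I) : 'I_n./2 -> I :=
  fun i => E (Ordinal (half1_subproof i)).

Definition half2 (I : Type) (n : nat) (E : 'I_n -> I) : 'I_n./2 -> I :=
  fun i => E (Ordinal (half2_subproof i)).

(* The recursion is on a bound f on n: recursive calls are made on arrays of
   size at most n./2, so the case f = 0 is only met for n = 0 when the initial
   bound is n. *)
Fixpoint attenuate_rec (Halver Sort : forall n : nat, network 'I_(n + n))
    (I : Type) (f n : nat) (A B : 'I_n -> I) {struct f} : network I :=
  if f isn't f'.+1 then [::]
  else if n <= 8 then call (Sort n) A B
  else
    let A1 := half1 A in let A2 := half2 A in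
    let B1 := half1 B in let B2 := half2 B in
    let A21 := half1 A2 in let A22 := half2 A2 in
    let B11 := half1 B1 in let B12 := half2 B1 in
    call (Halver _) A1 A2 ++
    call (Halver _) B1 B2 ++
    call (Halver _) A2 B1 ++
    attenuate_rec Halver Sort f' A2 B1 ++
    call (Halver _) A21 A22 ++
    call (Halver _) B11 B12 ++
    call (Halver _) A22 B11 ++
    attenuate_rec Halver Sort f' A22 B11.

Definition attenuate (Halver Sort : forall n : nat, network 'I_(n + n))
    (I : Type) (n : nat) (A B : 'I_n -> I) : network I :=
  attenuate_rec Halver Sort n A B.

Definition prefaced_attenuate (Halver Sort : forall n : nat, network 'I_(n + n))
    (n : nat) : network 'I_(n + n) :=
  let A := @lshift n n in let B := @rshift n n in
  call (Halver n) A B ++ attenuate Halver Sort A B.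

Definition log2 (R : realType) (x : R) : R := (ln x / ln 2)%R.

(* Main.v *)
Require Import Defs.
From HB Require Import structures.
From mathcomp Require Import all_boot all_order all_algebra all_fingroup.
From mathcomp Require Import reals exp.
From mathcomp Require Import lra zify.

Set Implicit Arguments.
Unset Strict Implicit.
Unset Printing Implicit Defensive.

Import Order.TTheory GRing.Theory Num.Theory.

(* Mark the entries of an up-closed set of values.  A halver moves the marked
   entries of its two arrays so that few end up in the first array or, if they
   do not fit in the second one, so that few unmarked entries end up in the
   second array; this property is self-dual, and it is preserved when the
   halver is run on a subset of the memory.  By induction on the size, the
   prefaced procedure has it with eps = 6 alpha^2 already, both recursive calls
   being prefaced ones on halves and quarters.  If more than n / 2 marked entries
   reach B, the last recursive call may leave eps * n / 4 <= eps * k / 2 of them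
   in A, and every other contribution is of order alpha^2 k; otherwise only
   O(alpha k) marked entries take part in the recursive calls.  As
   alpha <= 1/8 gives ceil(log2(1/alpha)) >= 3, the claimed eps is at least
   6 alpha^2. *)

(** * Arithmetic of the counts of marked entries *)

(* [a] and [b] count the marked entries in the two arrays, each of size [m]; when
   more than [m] entries are marked, the unmarked ones are bounded instead. *)
Definition halving_bound (R : realFieldType) (eps m a b : R) : Prop :=
  ((a + b <= m -> a <= eps * (a + b)) /\
   (m <= a + b -> m - b <= eps * ((m - b) + (m - a))))%R.

Local Open Scope ring_scope.

Lemma ler_or_gt (R : realFieldType) (x y : R) : x <= y \/ y < x.
Proof. by case: leP; [left|right]. Qed.

(** Self-duality: exchanging marked with unmarked entries and the first array with the second swaps
    the two clauses. *)
Lemma halving_bound_compl (R : realFieldType) (eps m a b : R) :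
  halving_bound eps m a b -> halving_bound eps m (m - b) (m - a).
Proof.
move=> [h1 h2]; split=> le_m; first by apply: h2; lra.
by rewrite !subKr; apply: h1; lra.
Qed.

(* The two arrays have size [4 * h].  An argument named after a subarray is the
   number of marked entries there right after the halver call separating it from
   its sibling; [x] and [y] are the final numbers in A22 and B11. *)
Lemma attenuate_count (R : realFieldType)
    (alpha eps h a1 a2 b1 b2 a21 a22 b11 b12 x y : R) :
  0 <= alpha -> alpha <= 1 / 8 -> 6 * alpha ^+ 2 <= eps -> eps <= 3 / 32 ->
  0 <= a1 <= 2 * h -> 0 <= a2 <= 2 * h -> 0 <= b1 <= 2 * h -> 0 <= b2 <= 2 * h ->
  0 <= a21 <= h -> 0 <= a22 <= h -> 0 <= b11 <= h -> 0 <= b12 <= h ->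
  0 <= x <= h -> 0 <= y <= h ->
  halving_bound alpha (4 * h) (a1 + a2) (b1 + b2) ->
  halving_bound alpha (2 * h) a1 a2 -> halving_bound alpha (2 * h) b1 b2 ->
  (a21 + a22) + (b11 + b12) = a2 + b1 ->
  halving_bound eps (2 * h) (a21 + a22) (b11 + b12) ->
  halving_bound alpha h a21 a22 -> halving_bound alpha h b11 b12 ->
  x + y = a22 + b11 -> halving_bound eps h x y ->
  (a1 + a21 + x) + (b2 + b12 + y) <= 4 * h ->
  a1 + a21 + x <= eps * ((a1 + a21 + x) + (b2 + b12 + y)).
Proof.
move=> al0 al8 le_eps eps_le.
move=> /andP[? ?] /andP[? ?] /andP[? ?] /andP[? ?] /andP[? ?] /andP[? ?].
move=> /andP[? ?] /andP[? ?] /andP[? ?] /andP[? ?].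
move=> H0 H1 H2 C3 H3 H4 H5 C6 H6 le_k.
have -> : a1 + a21 + x + (b2 + b12 + y) = a1 + a2 + (b1 + b2) by lra.
have {}le_k : a1 + a2 + (b1 + b2) <= 4 * h by lra.
have [k ek] : exists k, k = a1 + a2 + (b1 + b2) by eexists.
rewrite -ek in le_k *.
have eps0 : 0 <= eps by apply: le_trans le_eps; rewrite mulr_ge0 // sqr_ge0.
have alM z : 0 <= z -> 0 <= alpha * z <= z / 8.
  move=> z0; rewrite mulr_ge0 //=.
  by have := ler_wpM2r z0 al8; lra.
have epsM z : 0 <= z -> 0 <= eps * z <= 3 / 32 * z.
  by move=> z0; rewrite mulr_ge0 //= ler_wpM2r.
have k0 : 0 <= k by lra.
have Ha : a1 + a2 <= alpha * k by rewrite ek; apply: (proj1 H0); lra.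
have /andP[? ?] := alM _ k0.
have Ha1 : a1 <= alpha * (a1 + a2) by apply: (proj1 H1); lra.
have Hal2 : alpha * (a1 + a2) <= eps * k / 6.
  have := ler_wpM2l al0 Ha; have := ler_wpM2r k0 le_eps; rewrite expr2 -!mulrA; lra.
have /andP[? ?] := epsM _ k0.
(* If the marked entries of B fit in B2, then [a2] and [b1] are at most k/8 each, so at most k/4
   marked entries enter the first recursive call. The bounds on [a1], [a21], [x] are then 1/6, 1/32
   and 1/4 of [eps * k]. *)
have [leb|ltb] := ler_or_gt (b1 + b2) (2 * h).
  have Hb1 := proj1 H2 leb.
  have /andP[? ?] : 0 <= alpha * (b1 + b2) <= (b1 + b2) / 8 by apply: alM; lra.
  have Ha2' : a21 + a22 <= eps * (a21 + a22 + (b11 + b12)) by apply: (proj1 H3); lra.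
  have le_j : a21 + a22 + (b11 + b12) <= k / 4 by lra.
  have := ler_wpM2l eps0 le_j => ?.
  have Ha21 : a21 <= alpha * (a21 + a22) by apply: (proj1 H4); lra.
  have /andP[? ?] : 0 <= alpha * (a21 + a22) <= (a21 + a22) / 8 by apply: alM; lra.
  have Hx : x <= eps * (x + y) by apply: (proj1 H6); lra.
  have : eps * (x + y) <= eps * (k / 4) by apply: (ler_wpM2l eps0); lra.
  lra.
(* Now B holds more than 2h marked entries, so 2h < k, and the dual clause bounds the unmarked
   entries of B2. *)
have H2' : 2 * h - b2 <= alpha * (2 * h - b2 + (2 * h - b1)) by apply: (proj2 H2); lra.
have h0 : 0 <= 2 * h by lra.
have /andP[? ?] := epsM _ h0.
have le2h : eps * (2 * h) <= eps * k by apply: (ler_wpM2l eps0); lra.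
(* This is the excess of marked entries over the capacity of B1. The term [- a1] is kept because it
   cancels [a1] in the final sum. *)
have Hj : a2 + b1 - 2 * h <= alpha * (a1 + a2) - a1.
  have /andP[? ?] : 0 <= alpha * (4 * h - k) <= (4 * h - k) / 8 by apply: alM; lra.
  have : alpha * (2 * h - b2 + (2 * h - b1)) =
    alpha * (4 * h - k) + alpha * (a1 + a2) by rewrite -mulrDr ek; congr (_ * _); lra.
  lra.
(* Either the marked entries fit in B1, or the ones left in A2 are the excess plus as many as there
   are unmarked entries in B1. *)
have Ha2' : a21 + a22 <= alpha * (a1 + a2) + eps * (2 * h).
  have [lej|ltj] := ler_or_gt (a21 + a22 + (b11 + b12)) (2 * h).
    have := proj1 H3 lej; have := ler_wpM2l eps0 lej; lra.
  have H3' := proj2 H3 (ltW ltj).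
  have : eps * (2 * h - (b11 + b12) + (2 * h - (a21 + a22))) <= eps * (2 * h).
    by apply: (ler_wpM2l eps0); lra.
  lra.
have Ha21 : a21 <= alpha * (a21 + a22) by apply: (proj1 H4); lra.
have /andP[? ?] : 0 <= alpha * (a21 + a22) <= (a21 + a22) / 8 by apply: alM; lra.
(* The excess over the capacity of B11, one level down. If B1 has at most h marked entries there is
   none: [a22] is at most h/4 and [b11] at most h/8, while the right side is nonnegative. Again
   [- a21] is kept for cancellation. *)
have Hexc : x + y - h <= alpha * (a1 + a2) - a1 + alpha * (a21 + a22) - a21.
  have [leb'|ltb'] := ler_or_gt (b11 + b12) (h).
    have := proj1 H5 leb'.
    have /andP[? ?] : 0 <= alpha * (b11 + b12) <= (b11 + b12) / 8 by apply: alM; lra.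
    lra.
  have H5' : h - b12 <= alpha * (h - b12 + (h - b11)) by apply: (proj2 H5); lra.
  have [lej|ltj] := ler_or_gt (a2 + b1) (2 * h).
    have /andP[? ?] : 0 <= alpha * (2 * h - (a2 + b1)) <= (2 * h - (a2 + b1)) / 8.
      by apply: alM; lra.
    have : alpha * (h - b12 + (h - b11)) =
      alpha * (2 * h - (a2 + b1)) + alpha * (a21 + a22).
      by rewrite -mulrDr -C3; congr (_ * _); lra.
    lra.
  have : alpha * (h - b12 + (h - b11)) <= alpha * (a21 + a22).
    by apply: (ler_wpM2l al0); lra.
  lra.
(* In both cases the total is at most 1/6 + 7/48 + 1/2 = 39/48 of [eps * k], the last term being
   [eps * h] with 2h < k. *)
have [lexy|ltxy] := ler_or_gt (x + y) (h).
  have := proj1 H6 lexy; have := ler_wpM2l eps0 lexy; lra.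
have H6' := proj2 H6 (ltW ltxy).
have : eps * (h - y + (h - x)) <= eps * h by apply: (ler_wpM2l eps0); lra.
lra.
Qed.

(** The second clause is [attenuate_count] for the unmarked entries in the mirror image of the
    procedure, which exchanges A1 with B2, A2 with B1, A21 with B12 and A22 with B11. *)
Lemma attenuate_bound (R : realFieldType)
    (alpha eps h a1 a2 b1 b2 a21 a22 b11 b12 x y : R) :
  0 <= alpha -> alpha <= 1 / 8 -> 6 * alpha ^+ 2 <= eps -> eps <= 3 / 32 ->
  0 <= a1 <= 2 * h -> 0 <= a2 <= 2 * h -> 0 <= b1 <= 2 * h -> 0 <= b2 <= 2 * h ->
  0 <= a21 <= h -> 0 <= a22 <= h -> 0 <= b11 <= h -> 0 <= b12 <= h ->
  0 <= x <= h -> 0 <= y <= h ->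
  halving_bound alpha (4 * h) (a1 + a2) (b1 + b2) ->
  halving_bound alpha (2 * h) a1 a2 -> halving_bound alpha (2 * h) b1 b2 ->
  (a21 + a22) + (b11 + b12) = a2 + b1 ->
  halving_bound eps (2 * h) (a21 + a22) (b11 + b12) ->
  halving_bound alpha h a21 a22 -> halving_bound alpha h b11 b12 ->
  x + y = a22 + b11 -> halving_bound eps h x y ->
  halving_bound eps (4 * h) (a1 + a21 + x) (b2 + b12 + y).
Proof.
move=> al0 al8 le_eps eps_le ba1 ba2 bb1 bb2 ba21 ba22 bb11 bb12 bx bY.
move=> H0 H1 H2 C3 H3 H4 H5 C6 H6; split.
  exact: (@attenuate_count R alpha eps h a1 a2 b1 b2 a21 a22 b11 b12).
move=> le_m.
have E u v : 4 * h - (u + v) = (2 * h - v) + (2 * h - u) by lra.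
have E' u v : 2 * h - (u + v) = (h - v) + (h - u) by lra.
have F u v w : 4 * h - (u + v + w) = (2 * h - u) + (h - v) + (h - w) by lra.
have bnd (c z : R) : 0 <= z <= c -> 0 <= c - z <= c.
  by move=> /andP[? ?]; apply/andP; split; lra.
move/halving_bound_compl: H0; rewrite [4 * h - (b1 + b2)]E [4 * h - (a1 + a2)]E => H0.
move/halving_bound_compl: H3.
rewrite [2 * h - (b11 + b12)]E' [2 * h - (a21 + a22)]E' => H3.
rewrite [4 * h - (b2 + b12 + y)]F [4 * h - (a1 + a21 + x)]F.
apply: (@attenuate_count R alpha eps h (2 * h - b2) (2 * h - b1) (2 * h - a2)
  (2 * h - a1) (h - b12) (h - b11) (h - a22) (h - a21) (h - y) (h - x)
  al0 al8 le_eps eps_le (bnd _ _ bb2) (bnd _ _ bb1) (bnd _ _ ba2) (bnd _ _ ba1)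
  (bnd _ _ bb12) (bnd _ _ bb11) (bnd _ _ ba22) (bnd _ _ ba21) (bnd _ _ bY)
  (bnd _ _ bx) H0 (halving_bound_compl H2) (halving_bound_compl H1) _ H3
  (halving_bound_compl H5) (halving_bound_compl H4) _ (halving_bound_compl H6)); lra.
Qed.

Local Close Scope ring_scope.

(** * Runs permute the values *)

(** On given values, a compare-exchange acts as the identity or as a transposition; the permutation
    depends on the input. *)
Lemma run_perm (d : Order.disp_t) (T : orderType d) (I : finType)
    (net : network I) (t : I -> T) :
  exists s : {perm I}, run net t =1 t \o s.
Proof.
elim: net t => [|e net IH] t; first by exists 1%g => r; rewrite /= perm1.
have [s hs] : exists s : {perm I}, compare_exchange t e =1 t \o s.
  have [le12|lt21] := leP (t e.1) (t e.2).
    exists 1%g => r; rewrite /compare_exchange /= perm1.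
    rewrite (min_idPl le12) (max_idPr le12).
    by case: eqP => [->//|_]; case: eqP => [->|].
  exists (tperm e.1 e.2) => r; rewrite /compare_exchange /=.
  rewrite (min_idPr (ltW lt21)) (max_idPl (ltW lt21)).
  case: tpermP => [->|->|/eqP/negPf-> /eqP/negPf->//]; first by rewrite eqxx.
  by rewrite eqxx; case: eqP => [->|].
have [s' hs'] := IH (compare_exchange t e).
by exists (s' * s)%g => r; rewrite [LHS]hs' /= hs /= permM.
Qed.

Lemma run_inj (d : Order.disp_t) (T : orderType d) (I : finType)
    (net : network I) (t : I -> T) : injective t -> injective (run net t).
Proof.
move=> injt; have [s hs] := run_perm net t.
by move=> p q; rewrite !hs /= => /injt /perm_inj.
Qed.

Lemma card_run (d : Order.disp_t) (T : orderType d) (I : finType)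
    (P : pred T) (net : network I) (t : I -> T) :
  #|[set r | P (run net t r)]| = #|[set r | P (t r)]|.
Proof.
have [s hs] := run_perm net t.
have -> : [set r | P (run net t r)] = s @^-1: [set r | P (t r)].
  by apply/setP => r; rewrite !inE hs.
rewrite card_preimset //; exact: perm_inj.
Qed.

(** * Networks called on a part of the memory *)

(** This gives a name to the local function [addr] of [call], to which it is convertible. *)
Definition join_addr (I : Type) (n : nat) (A B : 'I_n -> I) (i : 'I_(n + n)) : I :=
  match split i with inl a => A a | inr b => B b end.

Lemma join_addr_lshift (I : Type) (n : nat) (A B : 'I_n -> I) (i : 'I_n) :
  join_addr A B (lshift n i) = A i.
Proof. by rewrite /join_addr -[lshift n i]/(unsplit (inl i)) unsplitK. Qed.

Lemma join_addr_rshift (I : Type) (n : nat) (A B : 'I_n -> I) (i : 'I_n) :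
  join_addr A B (rshift n i) = B i.
Proof. by rewrite /join_addr -[rshift n i]/(unsplit (inr i)) unsplitK. Qed.

Definition region (I : finType) (n : nat) (A : 'I_n -> I) : {set I} := A @: setT.

Lemma join_addr_inj (I : finType) (n : nat) (A B : 'I_n -> I) :
  injective A -> injective B -> [disjoint region A & region B] ->
  injective (join_addr A B).
Proof.
move=> injA injB dAB.
have ne a b : A a <> B b.
  move=> eab; move: (disjointFr dAB (imset_f A (in_setT a))).
  by rewrite eab imset_f ?inE.
move=> i j; rewrite /join_addr; case: split_ordP => a ->; case: split_ordP => b ->.
- by move/injA->.
- by move/ne.
- by move/esym/ne.
- by move/injB->.
Qed.

(** Injectivity of the addresses makes equality tests on addresses agree with those on indices, so
    each compare-exchange commutes with reading the two arrays. *)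
Lemma run_call (d : Order.disp_t) (T : orderType d) (I : finType) (n : nat)
    (net : network 'I_(n + n)) (A B : 'I_n -> I) (t : I -> T) :
  injective (join_addr A B) ->
  run (call net A B) t \o join_addr A B =1 run net (t \o join_addr A B).
Proof.
move=> inj.
have ext u v : u =1 v -> run net u =1 run net v.
  elim: net u v => [//|e net IH] u v uv; apply: IH => r.
  by rewrite /compare_exchange !uv.
suff H u : u =1 t \o join_addr A B ->
    run (call net A B) t \o join_addr A B =1 run net u by exact: H.
elim: net t u {ext} => [|e net IH] t u eu i; first by rewrite /= eu.
apply: (IH (compare_exchange t (join_addr A B e.1, join_addr A B e.2))) => r.
by rewrite /compare_exchange /= !(inj_eq inj) !eu.
Qed.

Lemma run_call_notin (d : Order.disp_t) (T : orderType d) (I : finType) (n : nat)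
    (net : network 'I_(n + n)) (A B : 'I_n -> I) (t : I -> T) (r : I) :
  r \notin region A :|: region B -> run (call net A B) t r = t r.
Proof.
move=> rAB.
have ne i : (r == join_addr A B i) = false.
  apply: contraNF rAB => /eqP->; rewrite /join_addr inE.
  by case: split => a; rewrite imset_f ?orbT.
elim: net t => [//|e net IH] t; rewrite [LHS]IH.
by rewrite /compare_exchange /= !ne.
Qed.

(** * Counting marked entries in a set of addresses *)

Definition count_in (T : Type) (I : finType) (P : pred T) (t : I -> T)
  (S : {set I}) : nat := #|[set r in S | P (t r)]|.

Lemma count_in_region (T : Type) (I : finType) (P : pred T) (t : I -> T)
    (n : nat) (A : 'I_n -> I) :
  injective A -> count_in P t (region A) = #|[set i | P (t (A i))]|.
Proof.
move=> injA; rewrite -(card_imset _ injA); congr #|pred_of_set _|.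
apply/setP => r; rewrite !inE; apply/andP/imsetP.
- by case=> /imsetP[i _ ->] Pi; exists i; rewrite ?inE.
- by case=> i; rewrite inE => Pi ->; rewrite imset_f ?inE.
Qed.

Lemma count_in_eq (T : Type) (I : finType) (P : pred T) (t u : I -> T)
    (S : {set I}) :
  {in S, t =1 u} -> count_in P t S = count_in P u S.
Proof.
move=> tu; congr #|pred_of_set _|; apply/setP => r; rewrite !inE.
by case rS: (r \in S) => //=; rewrite tu.
Qed.

Lemma count_inU (T : Type) (I : finType) (P : pred T) (t : I -> T)
    (S U : {set I}) :
  [disjoint S & U] -> count_in P t (S :|: U) = count_in P t S + count_in P t U.
Proof.
move=> dSU; rewrite /count_in -cardsUI.
have -> : [set r in S | P (t r)] :&: [set r in U | P (t r)] = set0.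
  apply/setP => r; rewrite !inE; case rS: (r \in S) => //=.
  by rewrite (disjointFr dSU rS) andbF.
rewrite cards0 addn0; congr #|pred_of_set _|.
by apply/setP => r; rewrite !inE andb_orl.
Qed.

Lemma count_in_le (T : Type) (I : finType) (P : pred T) (t : I -> T)
    (S : {set I}) : count_in P t S <= #|S|.
Proof. by apply: subset_leq_card; apply/subsetP => r; rewrite inE => /andP[]. Qed.

Lemma card_region (I : finType) (n : nat) (A : 'I_n -> I) :
  injective A -> #|region A| = n.
Proof. by move=> injA; rewrite card_imset // cardsT card_ord. Qed.

Lemma card_join (n : nat) (p : pred 'I_(n + n)) :
  #|[set q | p q]| = #|[set i | p (lshift n i)]| + #|[set i | p (rshift n i)]|.
Proof. by rewrite -!sum1dep_card big_split_ord. Qed.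

(** * Up-closed marks and ranks *)

Definition upclosed (d : Order.disp_t) (T : orderType d) (P : pred T) : Prop :=
  forall x y : T, (x <= y)%O -> P x -> P y.

(** Entries exceeding a marked one are marked, and all marked entries exceed an unmarked one. So
    with k marked entries, the marked ones are the k largest in the sense of [halver]. *)
Lemma upclosed_rank (d : Order.disp_t) (T : orderType d) (J : finType)
    (u : J -> T) (P : pred T) (p : J) : upclosed P ->
  P (u p) = (#|[set q | (u p < u q)%O]| < #|[set q | P (u q)]|).
Proof.
move=> upP; case Pp: (P (u p)); symmetry.
  apply: proper_card; apply/properP; split.
    by apply/subsetP => q; rewrite !inE => /ltW /upP; apply.
  by exists p; rewrite !inE ?ltxx.
apply/negbTE; rewrite -leqNgt; apply: subset_leq_card.
apply/subsetP => q; rewrite !inE => Pq; rewrite ltNge.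
by apply/negP => /upP /(_ Pq); rewrite Pp.
Qed.

Lemma card_top (d : Order.disp_t) (T : orderType d) (J : finType)
    (u : J -> T) (k : nat) : injective u ->
  #|[set p | #|[set q | (u p < u q)%O]| < k]| <= k.
Proof.
move=> inju; set S := [set p | _].
have [->|[p0 p0S]] := set_0Vmem S; first by rewrite cards0.
(* Every member of [S] other than its least one [p] exceeds [p], and fewer than k entries do. *)
case: (arg_minP u p0S) => p pS minp.
have lek : #|[set q | (u p < u q)%O]| < k by have : p \in S := pS; rewrite inE.
apply: leq_trans lek; rewrite -add1n.
have sub : S \subset p |: [set q | (u p < u q)%O].
  apply/subsetP => q qS; rewrite !inE -(inj_eq inju).
  by rewrite eq_sym -le_eqVlt minp.
by apply: leq_trans (subset_leq_card sub) _; rewrite cardsU1 leq_add2r leq_b1.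
Qed.

Lemma card_bottom (d : Order.disp_t) (T : orderType d) (J : finType)
    (u : J -> T) (k : nat) : injective u ->
  #|[set p | #|[set q | (u q < u p)%O]| < k]| <= k.
Proof. exact: (@card_top _ T^d J u k). Qed.

Lemma upclosed_corank (d : Order.disp_t) (T : orderType d) (J : finType)
    (u : J -> T) (P : pred T) (p : J) : upclosed P ->
  ~~ P (u p) = (#|[set q | (u q < u p)%O]| < #|[set q | ~~ P (u q)]|).
Proof.
move=> upP; apply: (@upclosed_rank _ T^d J u (predC P) p) => x y.
by move=> le_yx; apply: contra; apply: upP.
Qed.

(** * Halvers in terms of marked entries *)

(** The form in which calls compose inside a larger memory: a frame condition and conservation of
    marks, needed to carry counts from one call to the next, come with the halving bound. *)
Definition halves_on (R : realFieldType) (d : Order.disp_t) (T : orderType d)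
    (P : pred T) (eps : R) (n : nat) (I : finType) (net : network I)
    (SA SB : {set I}) : Prop :=
  forall t : I -> T, injective t -> let u := run net t in
  [/\ forall r, r \notin SA :|: SB -> u r = t r,
      count_in P u SA + count_in P u SB = count_in P t SA + count_in P t SB
    & halving_bound eps n%:R (count_in P u SA)%:R (count_in P u SB)%:R].

Lemma halves_call (R : realFieldType) (d : Order.disp_t) (T : orderType d)
    (P : pred T) (eps : R) (n : nat) (I : finType) (net : network 'I_(n + n))
    (A B : 'I_n -> I) :
  upclosed P -> halver T eps net -> injective A -> injective B ->
  [disjoint region A & region B] ->
  halves_on P eps n (call net A B) (region A) (region B).
Proof.
move=> upP hnet injA injB dAB t injt u.
have injAB := join_addr_inj injA injB dAB.
pose v := run net (t \o join_addr A B).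
have uA i : u (A i) = v (lshift n i).
  by rewrite -[v _]run_call //= join_addr_lshift.
have uB i : u (B i) = v (rshift n i).
  by rewrite -[v _]run_call //= join_addr_rshift.
have cA : count_in P u (region A) = #|[set i | P (v (lshift n i))]|.
  by rewrite count_in_region //; apply: eq_card => i; rewrite !inE uA.
have cB : count_in P u (region B) = #|[set i | P (v (rshift n i))]|.
  by rewrite count_in_region //; apply: eq_card => i; rewrite !inE uB.
have cAB : count_in P u (region A) + count_in P u (region B) = #|[set q | P (v q)]|.
  by rewrite card_join cA cB.
have injtAB : injective (t \o join_addr A B) by apply: inj_comp.
split.
- by move=> r; apply: run_call_notin.
- rewrite cAB card_run card_join !count_in_region //.
  by congr (_ + _); apply: eq_card => i; rewrite !inE /=;
    rewrite ?join_addr_lshift ?join_addr_rshift.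
have compl (J : finType) (p : pred J) : #|[set q | ~~ p q]| + #|[set q | p q]| = #|J|.
  rewrite -(cardsC [set q | p q]) addnC; congr (_ + _).
  by apply: eq_card => q; rewrite !inE.
have leA : count_in P u (region A) <= n by rewrite -{2}(card_region injA) count_in_le.
have leB : count_in P u (region B) <= n by rewrite -{2}(card_region injB) count_in_le.
split; rewrite -natrD ler_nat => le_n.
  (* The halver property is used with k the number of marked entries. *)
  have [+ _] := hnet _ injtAB _ le_n.
  rewrite cA; congr (_%:R <= _)%R; apply: eq_card => i; rewrite !inE.
  by rewrite (upclosed_rank v (lshift n i) upP) -cAB cA.
(* With more marks than one array can hold, k is the number of unmarked entries instead. *)
have cC : (n - count_in P u (region B)) + (n - count_in P u (region A)) =
    #|[set q | ~~ P (v q)]|.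
  apply/eqP; rewrite -(eqn_add2r #|[set q | P (v q)]|) compl card_ord -cAB.
  by rewrite [count_in _ _ _ + _]addnC addnACA !subnK.
rewrite -!natrB // -natrD cC.
have le_n' : #|[set q | ~~ P (v q)]| <= n.
  rewrite -(leq_add2r #|[set q | P (v q)]|) compl card_ord leq_add2l -cAB //.
have [_ +] := hnet _ injtAB _ le_n'.
congr (_%:R <= _)%R.
apply/eqP; rewrite -(eqn_add2r (count_in P u (region B))) subnK // cB.
rewrite -[X in _ == X]card_ord -(compl _ (fun i => P (v (rshift n i)))) eqn_add2r.
apply/eqP; apply: eq_card => i; rewrite !inE.
by rewrite (upclosed_corank v (rshift n i) upP).
Qed.

(** For each input and each k, the marks are read off the output itself, which is possible because
    the hypothesis covers every up-closed [P]. *)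
Lemma halver_of_halves (R : realFieldType) (d : Order.disp_t) (T : orderType d)
    (eps : R) (n : nat) (net : network 'I_(n + n)) : (0 <= eps)%R ->
  (forall P : pred T, upclosed P ->
    halves_on P eps n net (region (@lshift n n)) (region (@rshift n n))) ->
  halver T eps net.
Proof.
move=> eps0 hnet t injt k le_k u large small.
have inju : injective u by apply: run_inj.
have injl : injective (@lshift n n) by apply: lshift_inj.
have injr : injective (@rshift n n) by apply: rshift_inj.
split.
  (* Marking the k largest outputs gives at most k <= n marks, so the first clause applies. *)
  pose P x := #|[set q | (x < u q)%O]| < k.
  have upP : upclosed P.
    move=> x y le_xy; apply: leq_ltn_trans; apply/subset_leq_card/subsetP => q.
    by rewrite !inE; apply: le_lt_trans.
  have [_ _ [+ _]] := hnet P upP t injt.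
  rewrite -/u !count_in_region // -natrD -(card_join (fun q => P (u q))) ler_nat.
  have le : #|[set q | P (u q)]| <= k by apply: card_top.
  move=> /(_ (leq_trans le le_k)) /le_trans; apply.
  by rewrite ler_wpM2l // ler_nat.
(* Here the k smallest outputs are the unmarked ones. At least n outputs are marked, so the second
   clause applies and bounds the unmarked ones in B. *)
pose P x := ~~ (#|[set q | (u q < x)%O]| < k).
have upP : upclosed P.
  move=> x y le_xy; apply: contra; apply: leq_ltn_trans.
  apply/subset_leq_card/subsetP => q.
  by rewrite !inE => /lt_le_trans; apply.
have [_ _ [_ +]] := hnet P upP t injt.
rewrite -/u !count_in_region //.
have cC (a : 'I_n -> 'I_(n + n)) :
    (n%:R - #|[set i | P (u (a i))]|%:R = #|[set i | small (a i)]|%:R :> R)%R.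
  apply/eqP; rewrite subr_eq -natrD eqr_nat -{1}(card_ord n).
  rewrite -(cardsC [set i | small (a i)]); apply/eqP; congr (_ + _).
  by apply: eq_card => i; rewrite !inE.
rewrite !cC -!natrD -(card_join (fun q => P (u q))) addnC -(card_join small).
have le : #|[set q | small q]| <= k by apply: card_bottom.
move=> H; apply: le_trans (H _) _; last by rewrite ler_wpM2l // ler_nat.
rewrite ler_nat -(leq_add2l n) -{1}(card_ord (n + n)) -(cardsC [set q | small q]).
apply: leq_add; first exact: leq_trans le_k.
by apply/subset_leq_card/subsetP => q; rewrite !inE.
Qed.

Lemma halver_mono (R : numDomainType) (d : Order.disp_t) (T : orderType d)
    (e1 e2 : R) (n : nat) (net : network 'I_(n + n)) :
  (e1 <= e2)%R -> halver T e1 net -> halver T e2 net.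
Proof.
move=> le_e hnet t injt k le_k; have [h1 h2] := hnet t injt k le_k.
by split; [apply: le_trans h1 _|apply: le_trans h2 _]; rewrite ler_wpM2r.
Qed.

(** After sorting distinct values, all n entries of B exceed each entry of A, so for k <= n no entry
    of A is among the k largest; dually for B. *)
Lemma sorting_network_halver (R : numDomainType) (d : Order.disp_t)
    (T : orderType d) (n : nat) (net : network 'I_(n + n)) :
  sorting_network T net -> halver T (0 : R)%R net.
Proof.
move=> srt t injt k le_k u large small.
have inju : injective u by apply: run_inj.
have lt_lr i j : (u (lshift n i) < u (rshift n j))%O.
  rewrite lt_neqAle (inj_eq inju) eq_lrshift srt //=.
  by rewrite (leq_trans (ltnW (ltn_ord i))) ?leq_addr.
rewrite mul0r; split.
  rewrite [X in (X%:R)%R]eq_card0 // => i; rewrite !inE; apply/negbTE.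
  rewrite -leqNgt (leq_trans le_k) // -[X in X <= _]card_ord.
  rewrite -(card_imset _ (@rshift_inj n n)); apply/subset_leq_card/subsetP => q.
  by case/imsetP => j _ ->; rewrite inE.
rewrite [X in (X%:R)%R]eq_card0 // => i; rewrite !inE; apply/negbTE.
rewrite -leqNgt (leq_trans le_k) // -[X in X <= _]card_ord.
rewrite -(card_imset _ (@lshift_inj n n)); apply/subset_leq_card/subsetP => q.
by case/imsetP => j _ ->; rewrite inE.
Qed.

(** * Concatenated networks and halves of arrays *)

Lemma run_cat (d : Order.disp_t) (T : orderType d) (I : eqType)
    (net1 net2 : network I) (t : I -> T) :
  run (net1 ++ net2) t = run net2 (run net1 t).
Proof. exact: foldl_cat. Qed.

Lemma pow2_half (n : nat) : pow2 n -> 1 < n -> pow2 n./2 /\ n = n./2 + n./2.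
Proof.
case=> [[|m]] -> // _; rewrite expnS mul2n doubleK addnn.
by split; first exists m.
Qed.

Lemma half1_inj (I : Type) (n : nat) (E : 'I_n -> I) :
  injective E -> injective (half1 E).
Proof. by move=> injE i j /injE [] /val_inj. Qed.

Lemma half2_inj (I : Type) (n : nat) (E : 'I_n -> I) :
  injective E -> injective (half2 E).
Proof. by move=> injE i j /injE [] /addnI /val_inj. Qed.

Lemma region_half (I : finType) (n : nat) (E : 'I_n -> I) :
  n = n./2 + n./2 -> region E = region (half1 E) :|: region (half2 E).
Proof.
move=> en; apply/setP => r; rewrite inE; apply/imsetP/orP.
  case=> i _ ->; have [lt_i|le_i] := ltnP i n./2; [left|right]; apply/imsetP.
    by exists (Ordinal lt_i) => //; congr E; apply: val_inj.
  have lt_i : i - n./2 < n./2 by rewrite ltn_subLR // -en.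
  by exists (Ordinal lt_i) => //; congr E; apply: val_inj; rewrite /= subnKC.
by case=> /imsetP[i _ ->]; eexists.
Qed.

Lemma disjoint_half (I : finType) (n : nat) (E : 'I_n -> I) :
  injective E -> [disjoint region (half1 E) & region (half2 E)].
Proof.
move=> injE; apply/pred0P => r /=; apply/negP => /andP[/imsetP[i _ ->]].
case/imsetP => j _ /injE [] eij; have := ltn_ord i.
by rewrite eij ltnNge leq_addr.
Qed.

(** * Induction on the array size *)

Lemma attenuate_total (a1 a2 b1 b2 a21 a22 b11 b12 x y : nat) :
  a21 + a22 + (b11 + b12) = a2 + b1 -> x + y = a22 + b11 ->
  a1 + a21 + x + (b2 + b12 + y) = a1 + a2 + (b1 + b2).
Proof. lia. Qed.

(** Shows that a stage with frame condition [f] leaves the count in a disjoint region unchanged, by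
    cases on membership in the six regions of [dis]. *)
Ltac by_frame frame f dis eB eB1 eA2 :=
  let r := fresh "r" in
  apply: (frame _ _ _ _ _ f) => r; move: (dis r); rewrite ?eB ?eB1 ?eA2 !inE;
  by do 6![case: (_ \in region _)].

(** The preface is part of the statement so that the induction hypothesis covers each recursive call
    together with the halver call on the same pair before it. The same [eps] serves at every
    depth. *)
Lemma halves_attenuate (R : realFieldType) (d : Order.disp_t) (T : orderType d)
    (P : pred T) (alpha eps : R) (Halver Sort : forall n, network 'I_(n + n))
    (I : finType) :
  (0 <= alpha -> alpha <= 1 / 8 -> 6 * alpha ^+ 2 <= eps -> eps <= 3 / 32 ->
  upclosed P ->
  (forall n : nat, pow2 n -> halver T alpha (Halver n)) ->
  (forall n : nat, pow2 n -> (n <= 8)%N -> sorting_network T (Sort n)) ->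
  forall (f n : nat) (A B : 'I_n -> I), (n <= f)%N -> pow2 n ->
  injective A -> injective B -> [disjoint region A & region B] ->
  halves_on P eps n
    (call (Halver n) A B ++ attenuate_rec Halver Sort f A B) (region A) (region B))%R.
Proof.
move=> al0 al8 le_eps eps_le upP hH hS.
have eps0 : (0 <= eps)%R by apply: le_trans le_eps; rewrite mulr_ge0 ?sqr_ge0.
elim=> [|f IH] n A B le_f p2n injA injB dAB.
  by case: p2n => m en; move: le_f; rewrite {1}en leqn0 expn_eq0.
have H0 := halves_call upP (hH _ p2n) injA injB dAB.
rewrite /=; case: ifP => [le8|/negbT]; last rewrite -ltnNge => lt8.
  (* For small sizes the preface only permutes entries of the two arrays, and the sort alone gives
     the bound. *)
  have HS : halver T eps (Sort n).
    apply: (halver_mono eps0); apply: sorting_network_halver; exact: hS.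
  have H1 := halves_call upP HS injA injB dAB.
  move=> t injt; rewrite run_cat.
  have [fr0 c0 _] := H0 t injt.
  have [fr1 c1 s1] := H1 _ (run_inj (net := call (Halver n) A B) injt).
  split=> // [r rAB|]; first by rewrite fr1 // fr0.
  by rewrite c1.
have lt1 : 1 < n by apply: leq_trans lt8.
have [p2h en] := pow2_half p2n lt1.
have lt1h : 1 < n./2 by rewrite -ltn_double -[X in _ < X]addnn -en; apply: leq_trans lt8.
have [p2q eh] := pow2_half p2h lt1h.
have le_hf : n./2 <= f.
  by rewrite -ltnS (leq_trans _ le_f) // [X in _ < X]en -{1}[n./2]add0n ltn_add2r ltnW.
have le_qf : n./2./2 <= f by rewrite (leq_trans _ le_hf) // [X in _ <= X]eh leq_addr.
set A1 := half1 A; set A2 := half2 A; set B1 := half1 B; set B2 := half2 B.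
set A21 := half1 A2; set A22 := half2 A2; set B11 := half1 B1; set B12 := half2 B1.
have iA1 : injective A1 := half1_inj injA.
have iA2 : injective A2 := half2_inj injA.
have iB1 : injective B1 := half1_inj injB.
have iB2 : injective B2 := half2_inj injB.
have iA21 : injective A21 := half1_inj iA2.
have iA22 : injective A22 := half2_inj iA2.
have iB11 : injective B11 := half1_inj iB1.
have iB12 : injective B12 := half2_inj iB1.
have eA : region A = region A1 :|: region A2 := region_half A en.
have eB : region B = region B1 :|: region B2 := region_half B en.
have eA2 : region A2 = region A21 :|: region A22 := region_half A2 eh.
have eB1 : region B1 = region B11 :|: region B12 := region_half B1 eh.
have dA : [disjoint region A1 & region A2] := disjoint_half injA.
have dB : [disjoint region B1 & region B2] := disjoint_half injB.
have dA2 : [disjoint region A21 & region A22] := disjoint_half iA2.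
have dB1 : [disjoint region B11 & region B12] := disjoint_half iB1.
(* The six regions are pairwise disjoint, encoded as a sum of booleans so that case analysis on
   membership settles every disjointness goal. *)
have dis r : (r \in region A1) + (r \in region A21) + (r \in region A22)
    + (r \in region B11) + (r \in region B12) + (r \in region B2) <= 1.
  move: (pred0P dAB r) (pred0P dA r) (pred0P dB r) (pred0P dA2 r) (pred0P dB1 r).
  rewrite /= eA eB !eA2 !eB1 !inE.
  by do 6![case: (_ \in region _)].
have disj (S U : {set I}) : (forall r, ~~ ((r \in S) && (r \in U))) -> [disjoint S & U].
  by move=> H; apply/pred0P => r /=; apply/negbTE.
have dA2B1 : [disjoint region A2 & region B1].
  apply: disj => r; move: (dis r); rewrite eA2 eB1 !inE.
  by do 6![case: (_ \in region _)].
have dA22B11 : [disjoint region A22 & region B11].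
  by apply: disj => r; move: (dis r); do 6![case: (_ \in region _)].
have H1 := halves_call upP (hH _ p2h) iA1 iA2 dA.
have H2 := halves_call upP (hH _ p2h) iB1 iB2 dB.
have H3 := IH _ _ _ le_hf p2h iA2 iB1 dA2B1.
have H4 := halves_call upP (hH _ p2q) iA21 iA22 dA2.
have H5 := halves_call upP (hH _ p2q) iB11 iB12 dB1.
have H6 := IH _ _ _ le_qf p2q iA22 iB11 dA22B11.
move=> t0 it0.
(* Regrouping pairs each recursive call with the halver call that prefaces it, which leaves seven
   stages. *)
have -> : call (Halver n) A B ++ call (Halver n./2) A1 A2 ++
    call (Halver n./2) B1 B2 ++ call (Halver n./2) A2 B1 ++
    attenuate_rec Halver Sort f A2 B1 ++ call (Halver n./2./2) A21 A22 ++
    call (Halver n./2./2) B11 B12 ++ call (Halver n./2./2) A22 B11 ++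
    attenuate_rec Halver Sort f A22 B11 =
  call (Halver n) A B ++ call (Halver n./2) A1 A2 ++
    call (Halver n./2) B1 B2 ++ (call (Halver n./2) A2 B1 ++
    attenuate_rec Halver Sort f A2 B1) ++ call (Halver n./2./2) A21 A22 ++
    call (Halver n./2./2) B11 B12 ++ (call (Halver n./2./2) A22 B11 ++
    attenuate_rec Halver Sort f A22 B11) by rewrite !catA.
rewrite !run_cat -!(run_cat (call (Halver n./2) A2 B1)).
rewrite -!(run_cat (call (Halver n./2./2) A22 B11)).
(* The memory after stage i is [ti]; [fi], [ci] and [si] are its frame condition, conservation of
   marks and halving bound. *)
have [] := H0 _ it0; have := run_inj (net := call (Halver n) A B) it0.
move: (run (call (Halver n) A B) t0) => t1 it1 f1 c1 s1.
have [] := H1 _ it1; have := run_inj (net := call (Halver n./2) A1 A2) it1.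
move: (run _ t1) => t2 it2 f2 c2 s2.
have [] := H2 _ it2; have := run_inj (net := call (Halver n./2) B1 B2) it2.
move: (run _ t2) => t3 it3 f3 c3 s3.
have [] := H3 _ it3; have := run_inj (net := call (Halver n./2) A2 B1 ++
    attenuate_rec Halver Sort f A2 B1) it3.
move: (run _ t3) => t4 it4 f4 c4 s4.
have [] := H4 _ it4; have := run_inj (net := call (Halver n./2./2) A21 A22) it4.
move: (run _ t4) => t5 it5 f5 c5 s5.
have [] := H5 _ it5; have := run_inj (net := call (Halver n./2./2) B11 B12) it5.
move: (run _ t5) => t6 it6 f6 c6 s6.
have [] := H6 _ it6.
move: (run _ t6) => t7 f7 c7 s7.
clear H0 H1 H2 H3 H4 H5 H6 IH hH hS.
have frame (S U V : {set I}) (t u : I -> T) :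
    (forall r, r \notin U :|: V -> u r = t r) ->
    (forall r, ~~ ((r \in S) && (r \in U :|: V))) -> count_in P u S = count_in P t S.
  move=> fr dS; apply: count_in_eq => r rS; apply: fr.
  by have := dS r; rewrite rS.
(* A name such as [A1_3] records that stage 3 does not affect the count in A1. *)
have B_2 : count_in P t2 (region B) = count_in P t1 (region B).
  by_frame frame f2 dis eB eB1 eA2.
have A1_3 : count_in P t3 (region A1) = count_in P t2 (region A1).
  by_frame frame f3 dis eB eB1 eA2.
have A2_3 : count_in P t3 (region A2) = count_in P t2 (region A2).
  by_frame frame f3 dis eB eB1 eA2.
have A1_4 : count_in P t4 (region A1) = count_in P t3 (region A1).
  by_frame frame f4 dis eB eB1 eA2.
have B2_4 : count_in P t4 (region B2) = count_in P t3 (region B2).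
  by_frame frame f4 dis eB eB1 eA2.
have A1_5 : count_in P t5 (region A1) = count_in P t4 (region A1).
  by_frame frame f5 dis eB eB1 eA2.
have B1_5 : count_in P t5 (region B1) = count_in P t4 (region B1).
  by_frame frame f5 dis eB eB1 eA2.
have B2_5 : count_in P t5 (region B2) = count_in P t4 (region B2).
  by_frame frame f5 dis eB eB1 eA2.
have A1_6 : count_in P t6 (region A1) = count_in P t5 (region A1).
  by_frame frame f6 dis eB eB1 eA2.
have A21_6 : count_in P t6 (region A21) = count_in P t5 (region A21).
  by_frame frame f6 dis eB eB1 eA2.
have A22_6 : count_in P t6 (region A22) = count_in P t5 (region A22).
  by_frame frame f6 dis eB eB1 eA2.
have B2_6 : count_in P t6 (region B2) = count_in P t5 (region B2).
  by_frame frame f6 dis eB eB1 eA2.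
have A1_7 : count_in P t7 (region A1) = count_in P t6 (region A1).
  by_frame frame f7 dis eB eB1 eA2.
have A21_7 : count_in P t7 (region A21) = count_in P t6 (region A21).
  by_frame frame f7 dis eB eB1 eA2.
have B12_7 : count_in P t7 (region B12) = count_in P t6 (region B12).
  by_frame frame f7 dis eB eB1 eA2.
have B2_7 : count_in P t7 (region B2) = count_in P t6 (region B2).
  by_frame frame f7 dis eB eB1 eA2.
(* Each count is now expressed at the stage where [attenuate_bound] reads it: [t2] for A1 and A2,
   [t3] for B1 and B2, [t5] for A21 and A22, [t6] for B11 and B12, [t7] for the final A22 and
   B11. *)
have tA : count_in P t1 (region A) =
    count_in P t2 (region A1) + count_in P t2 (region A2).
  by rewrite eA count_inU.
have tB : count_in P t1 (region B) =
    count_in P t3 (region B1) + count_in P t3 (region B2).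
  by rewrite -B_2 eB count_inU.
have tA2 : count_in P t4 (region A2) =
    count_in P t5 (region A21) + count_in P t5 (region A22).
  by rewrite eA2 count_inU.
have tB1 : count_in P t4 (region B1) =
    count_in P t6 (region B11) + count_in P t6 (region B12).
  by rewrite -B1_5 eB1 count_inU.
have uA : count_in P t7 (region A) =
    count_in P t2 (region A1) + count_in P t5 (region A21) + count_in P t7 (region A22).
  by rewrite eA count_inU // eA2 count_inU // addnA; congr (_ + _ + _); congruence.
have uB : count_in P t7 (region B) =
    count_in P t3 (region B2) + count_in P t6 (region B12) + count_in P t7 (region B11).
  rewrite eB count_inU // eB1 count_inU // addnC.
  rewrite [(_ + count_in _ _ (region B12))]addnC addnA.
  by congr (_ + _ + _); congruence.
move: c4 c7 s4 s1; rewrite tA2 tB1 A2_3 A22_6 tA tB => c4 c7 s4 s1.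
split.
- move=> r rAB; have [rA1 rA2 rB1 rB2] : [/\ r \notin region A1, r \notin region A2,
      r \notin region B1 & r \notin region B2].
    by move: rAB; rewrite eA eB !inE !negb_or => /andP[/andP[-> ->] /andP[-> ->]].
  have [rA21 rA22] : r \notin region A21 /\ r \notin region A22.
    by move: rA2; rewrite eA2 !inE negb_or => /andP.
  have [rB11 rB12] : r \notin region B11 /\ r \notin region B12.
    by move: rB1; rewrite eB1 !inE negb_or => /andP.
  have notinU (S U : {set I}) : r \notin S -> r \notin U -> r \notin S :|: U.
    by move=> rS rU; rewrite inE negb_or rS.
  rewrite f7 ?f6 ?f5 ?f4 ?f3 ?f2 ?f1 //; exact: notinU.
- by rewrite -c1 uA uB tA tB; exact: attenuate_total c4 c7.
have leA (t : I -> T) (m : nat) (E : 'I_m -> I) : injective E ->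
    (0 <= (count_in P t (region E))%:R <= (m%:R : R))%R.
  by move=> iE; rewrite ler0n ler_nat /= -[X in _ <= X](card_region iE) count_in_le.
have e2 : (n./2%:R = 2 * n./2./2%:R :> R)%R by rewrite {1}eh natrD mulr_natl mulr2n.
have e4 : (n%:R = 4 * n./2./2%:R :> R)%R by rewrite {1}en natrD e2 -mulrDl -natrD.
rewrite uA uB !natrD e4.
rewrite !natrD e4 ?e2 in s1 s4.
rewrite e2 in s2 s3.
apply: (@attenuate_bound R alpha eps n./2./2%:R _ (count_in P t2 (region A2))%:R
  (count_in P t3 (region B1))%:R _ _ (count_in P t5 (region A22))%:R
  (count_in P t6 (region B11))%:R) => //; rewrite -?natrD ?c4 ?c7 -?e2 //; exact: leA.
Qed.

(** * The constant in the theorem *)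

Lemma log2_ge3 (R : realType) (x : R) : (8 <= x -> 3 <= log2 x)%R.
Proof.
move=> le8x; have ln2_gt0 : (0 < ln 2 :> R)%R by rewrite ln_gt0 // ltr1n.
rewrite /log2 ler_pdivlMr // mulr_natl -lnXn ?ltr0n // ler_ln ?posrE //.
- by rewrite -natrX.
- by rewrite exprn_gt0 ?ltr0n.
- by apply: lt_le_trans le8x; rewrite ltr0n.
Qed.

Theorem theorem4 (R : realType) (d : Order.disp_t) (T : orderType d)
    (alpha : R)
    (Halver Sort : forall n : nat, network 'I_(n + n)) :
  (0 < alpha)%R -> (alpha <= 1 / 8)%R ->
  (forall n : nat, pow2 n -> halver T alpha (Halver n)) ->
  (forall n : nat, pow2 n -> n <= 8 -> sorting_network T (Sort n)) ->
  forall n : nat, pow2 n ->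
    halver T (alpha ^+ 2 * ((Num.ceil (log2 (1 / alpha)))%:~R + 3))%R
      (prefaced_attenuate Halver Sort n).
Proof.
move=> al0 al8 hH hS n p2n.
have le_eps : (6 * alpha ^+ 2 <=
    alpha ^+ 2 * ((Num.ceil (log2 (1 / alpha)))%:~R + 3))%R.
  rewrite mulrC ler_wpM2l ?sqr_ge0 //.
  have le8 : (8 <= 1 / alpha)%R by rewrite ler_pdivlMr //; lra.
  have := le_trans (log2_ge3 le8) (ceil_ge _); lra.
(* From here the bound is [6 * alpha ^+ 2], at most 6/64 = 3/32 as the induction requires. *)
apply: (halver_mono le_eps).
apply: halver_of_halves; first by rewrite mulr_ge0 ?sqr_ge0.
move=> P upP; apply: (halves_attenuate (alpha := alpha)) => //.
- exact: ltW.
- rewrite expr2; have := ler_wpM2l (ltW al0) al8; lra.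
- exact: lshift_inj.
- exact: rshift_inj.
- apply/pred0P => r /=; apply/negP => /andP[/imsetP[i _ ->] /imsetP[j _]].
  by move/eqP; rewrite eq_lrshift.
Qed.
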